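(* Let $\delta,\varepsilon>0$ and let $T>0$ be an integer with $2T\le n$. Let $(\Sigma,\{\Theta_t\})$ be a $(T,\delta,\varepsilon)$-almost-periodic discrete-time dynamical system with $\Sigma\subseteq\mathbb{C}^n$. Then $(\Sigma,\{\Theta_t\})$ is $(\mathbb{Z}/T,\varepsilon)$-controlled; that is, for every $T$-system of history vectors $\mathbb{H}[\Sigma,T]=\{v_1,\ldots,v_T\}$ for $(\Sigma,\{\Theta_t\})$, the triple $(\Sigma,\{\Theta_t\},\mathbb{H}[\Sigma,T])$ is $(\mathbb{Z}/T,\varepsilon)$-controlled.
   Context: A discrete-time dynamical system $(\Sigma,\{\Theta_t\})$ consists of a set $\Sigma\subseteq\mathbb{C}^n$ and continuous maps $\Theta_t:\Sigma\to\Sigma$ with $\Theta_0=\mathrm{id}_\Sigma$ and $\Theta_t\circ\Theta_s=\Theta_{t+s}$ for all integers $t,s\ge 0$. It is $T$-periodic if $\Theta_{t+T}=\Theta_t$ for every integer $t\ge 0$. It is $(T,\delta,\varepsilon)$-almost-periodic if there is a $T$-periodic discrete-time dynamical system $(\tilde\Sigma,\{\tilde\Theta_t\})$ with $\tilde\Sigma\subseteq\mathbb{C}^n$ such that for each $x\in\Sigma$ there is $\tilde x\in\tilde\Sigma$ with $\|x-\tilde x\|_2\le\delta$, and $\|\Theta_t(x)-\tilde\Theta_t(\tilde x)\|_2\le\varepsilon$ for every integer $t\ge0$ and every $(x,\tilde x)\in\Sigma\times\tilde\Sigma$ with $\|x-\tilde x\|_2\le\delta$. A $T$-system of history vectors is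 $\mathbb{H}[\Sigma,T]=\{v_1,\ldots,v_T\}\subseteq\Sigma$ with $v_{k+1}=\Theta_k(v_1)$ for $0\le k\le T-1$ (so $v_{k+1}=\Theta_1(v_k)$ for $1\le k\le T-1$). A projection is a matrix $P$ with $P=P^\ast=P^2$. $\mathbb{C}[\mathbb{Z}/T]$ is the complex group algebra of the additive cyclic group $\mathbb{Z}/T=\{\hat0,\hat1,\ldots,\widehat{T-1}\}$. A unitary representation $\rho_T:\mathbb{C}[\mathbb{Z}/T]\to\mathbb{C}^{T\times T}$ is an algebra homomorphism whose restriction to $\mathbb{Z}/T$ is a group representation by unitary matrices. Other algebra homomorphisms are linear and multiplicative, not necessarily unit-preserving. For a polynomial $f\in\mathbb{C}[z]$, $f(\hat1)\in\mathbb{C}[\mathbb{Z}/T]$ is the evaluation of $f$ at the element $\hat1$ in the algebra $\mathbb{C}[\mathbb{Z}/T]$. The triple $(\Sigma,\{\Theta_t\},\mathbb{H}[\Sigma,T])$ is $(\mathbb{Z}/T,\varepsilon)$-controlled if there are a unitary representation $\rho_T:\mathbb{C}[\mathbb{Z}/T]\to\mathbb{C}^{T\times T}$, an algebra homomorphism $\varphi:\mathbb{C}^{T\times T}\to\mathbb{C}^{n\times n}$, polynomial functions $(f_k)_{k\ge0}$, all belonging to the finite family $\{f_0,\ldots,f_{T-1}\}$, two projections $\hat K,\hat T\in\mathbb{C}^{n\times n}$, and a vector $\tilde v\in\mathbb{C}^n$ such that $$\|\Theta_k(v_1)-\hat K\,\varphi(\rho_T(f_k(\hat1)))\,\hat T\,\tilde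 v\|_2\le\varepsilon\quad\text{for every }k\ge0.$$ *)

(* Defs.v *)
From HB Require Import structures.
From mathcomp Require Import all_boot all_order all_algebra all_fingroup.
From mathcomp Require Import spectral complex.
From mathcomp Require Import all_classical all_reals all_analysis.

Set Implicit Arguments.
Unset Strict Implicit.
Unset Printing Implicit Defensive.

Import Order.TTheory GRing.Theory Num.Theory.
Import numFieldNormedType.Exports.

Local Open Scope classical_set_scope.
Local Open Scope ring_scope.
Local Open Scope complex_scope.
Local Open Scope sesquilinear_scope.

(* The usual topology of the complex plane (given by the modulus); 'cV[R[i]]_n
   inherits from it the topology of C^n. *)
HB.instance Definition _ (R : realType) := NormedModule.copy R[i] (R[i]^o).

(* The group algebra R[G]: functions G -> R with the convolution product.  It
   is an alias of {ffun gT -> R}, whose own product is pointwise. *)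
Definition group_algebra (R : comNzRingType) (gT : finGroupType) : Type :=
  {ffun gT -> R}.

Section GroupAlgebra.
Variables (R : comNzRingType) (gT : finGroupType).
Implicit Types (g h : gT) (a b c : group_algebra R gT).

HB.instance Definition _ := GRing.Lmodule.copy (group_algebra R gT)
  {ffun gT -> R^o}.

Definition gabase g : group_algebra R gT := [ffun h => (h == g)%:R].

Definition gamul a b : group_algebra R gT :=
  [ffun g => \sum_h a h * b (h^-1 * g)%g].

Fact gamulA : associative gamul.
Proof.
move=> a b c; apply/ffunP => g; rewrite !ffunE.
under eq_bigr => h _ do rewrite ffunE mulr_sumr.
under [RHS]eq_bigr => k _ do rewrite ffunE mulr_suml.
rewrite [RHS]exchange_big /=; apply: eq_bigr => h _.
rewrite [RHS](reindex_inj (mulgI h)) /=; apply: eq_bigr => k _.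
by rewrite mulKg invMg mulrA mulgA.
Qed.

Fact gamul1 : left_id (gabase 1%g) gamul.
Proof.
move=> a; apply/ffunP => g; rewrite ffunE (bigD1 1%g) //= ffunE eqxx.
rewrite mul1r invg1 mul1g big1 ?addr0 // => h /negPf h1.
by rewrite ffunE h1 mul0r.
Qed.

Fact gamulr1 : right_id (gabase 1%g) gamul.
Proof.
move=> a; apply/ffunP => g; rewrite ffunE (bigD1 g) //= ffunE mulVg eqxx.
rewrite mulr1 big1 ?addr0 // => h hg.
by rewrite ffunE -eq_mulVg1 (negPf hg) mulr0.
Qed.

Fact gamulDl : left_distributive gamul +%R.
Proof.
move=> a b c; apply/ffunP => g; rewrite !ffunE -big_split /=.
by apply: eq_bigr => h _; rewrite ffunE mulrDl.
Qed.

Fact gamulDr : right_distributive gamul +%R.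
Proof.
move=> a b c; apply/ffunP => g; rewrite !ffunE -big_split /=.
by apply: eq_bigr => h _; rewrite ffunE mulrDr.
Qed.

Fact gabase1_neq0 : gabase 1%g != 0.
Proof.
apply/eqP => /ffunP /(_ 1%g); rewrite !ffunE eqxx => /eqP.
by rewrite oner_eq0.
Qed.

HB.instance Definition _ := GRing.Zmodule_isNzRing.Build (group_algebra R gT)
  gamulA gamul1 gamulr1 gamulDl gamulDr gabase1_neq0.

Fact gascaleAl (x : R) a b : x *: (a * b) = (x *: a) * b.
Proof.
apply/ffunP => g; rewrite !ffunE [LHS]mulr_sumr; apply: eq_bigr => h _.
by rewrite ffunE mulrA.
Qed.

HB.instance Definition _ :=
  GRing.Lmodule_isLalgebra.Build R (group_algebra R gT) gascaleAl.

Fact gascaleAr (x : R) a b : x *: (a * b) = a * (x *: b).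
Proof.
apply/ffunP => g; rewrite !ffunE [LHS]mulr_sumr; apply: eq_bigr => h _.
by rewrite ffunE mulrCA.
Qed.

HB.instance Definition _ :=
  GRing.Lalgebra_isAlgebra.Build R (group_algebra R gT) gascaleAr.

Fact gabaseM g h : gabase (g * h)%g = gabase g * gabase h.
Proof.
apply/ffunP => k; rewrite !ffunE (bigD1 g) //= !ffunE eqxx mul1r.
rewrite big1 ?addr0 => [|i /negPf ig]; last by rewrite ffunE ig mul0r.
by congr (nat_of_bool _)%:R; rewrite -(inj_eq (mulgI g^-1%g)) mulKg.
Qed.

End GroupAlgebra.

(* The additive group Z/T, for T > 0.  The type 'Z_T is not suitable, since
   'Z_1 has two elements. *)
Definition cyclic_group (T : nat) : finGroupType := 'I_T.-1.+1.

Section Definitions.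
Variable R : realType.
Local Notation C := R[i].

Definition norm2 n (x : 'cV[C]_n) : R :=
  Num.sqrt (\sum_(i < n) ComplexField.Normc.normc (x i ord0) ^+ 2).

Record discrete_system (n : nat) := DiscreteSystem {
  state_space : set 'cV[C]_n;
  flow : nat -> {fun state_space >-> state_space};
  flow_continuous : forall t : nat, {within state_space, continuous (flow t)};
  flow0 : forall x, state_space x -> flow 0%N x = x;
  flowD : forall t s x, state_space x -> flow t (flow s x) = flow (t + s)%N x
}.

Definition periodic n (T : nat) (D : discrete_system n) : Prop :=
  forall t x, state_space D x -> flow D (t + T)%N x = flow D t x.

Definition almost_periodic n (T : nat) (delta eps : R) (D : discrete_system n)
    : Prop :=
  exists D' : discrete_system n,
    [/\ periodic T D',
        forall x, state_space D x ->
          exists2 x', state_space D' x' & norm2 (x - x') <= delta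
      & forall (t : nat) x x', state_space D x -> state_space D' x' ->
          norm2 (x - x') <= delta ->
          norm2 (flow D t x - flow D' t x') <= eps].

(* Indices are shifted by one: v`_k stands for v_{k+1}. *)
Definition history_system n (T : nat) (D : discrete_system n)
    (v : T.-tuple 'cV[C]_n) : Prop :=
  (forall k, (k < T)%N -> state_space D v`_k) /\
  (forall k, (k < T)%N -> v`_k = flow D k v`_0).

Definition is_projection n (P : 'M[C]_n) : Prop := P = P^t* /\ P = P *m P.

(* A group representation maps the neutral element to the identity matrix, so
   rho is unital. *)
Definition unitary_representation (gT : finGroupType) d
    (rho : {linear group_algebra C gT -> 'M[C]_d}) : Prop :=
  monoid_morphism rho /\ forall g : gT, rho (gabase C g) \is unitarymx.

(* 1 in Z/T, as an element of C[Z/T]. *)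
Definition cyclic_gen (T : nat) : group_algebra C (cyclic_group T) :=
  gabase C (inZp 1 : cyclic_group T).

Definition controlled n (T : nat) (eps : R) (D : discrete_system n)
    (v : T.-tuple 'cV[C]_n) : Prop :=
  exists (rho : {linear group_algebra C (cyclic_group T) -> 'M[C]_T})
         (phi : {linear 'M[C]_T -> 'M[C]_n})
         (f : nat -> {poly C}) (K That : 'M[C]_n) (w : 'cV[C]_n),
    unitary_representation rho /\
    {morph phi : A B / A *m B >-> A *m B} /\
    (forall k, exists2 j, (j < T)%N & f k = f j) /\
    is_projection K /\ is_projection That /\
    (forall k : nat,
       norm2 (flow D k v`_0 -
              K *m phi (rho (horner_alg (cyclic_gen T) (f k))) *m That *m w)
       <= eps).

Definition controlled_system n (T : nat) (eps : R) (D : discrete_system n)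
    : Prop :=
  forall v : T.-tuple 'cV[C]_n, history_system D v -> controlled eps D v.

End Definitions.

(* Main.v *)
(* Let U be the n x T matrix whose columns are one period of the approximating
   orbit.  Since 2T <= n, the left kernel of U has dimension at least T, so it
   contains T orthonormal rows; let W be the T x n matrix they form: W U = 0 and
   W W^* = 1.  Then K = 1 - W^* W is a projection with K (U + W^* ) = U, and
   W (U + W^* ) = 1, so phi A = (U + W^* ) A W is multiplicative.  With rho the
   regular representation, f_k = X^(k mod T) and w = W^* e_0, the vector
   K phi(rho(f_k(1))) w = U rho(k) e_0 is the column k mod T of U. *)
From HB Require Import structures.
Require Import Defs.
From mathcomp Require Import all_boot all_order all_algebra all_fingroup.
From mathcomp Require Import spectral complex.
From mathcomp Require Import all_classical all_reals all_analysis.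

Import Order.TTheory GRing.Theory Num.Theory.
Local Open Scope ring_scope.
Local Open Scope sesquilinear_scope.

(** The left kernel of [U] has rank at least [n - p], so [pid_mx m] can pick [m] independent rows
    from a basis of it. Gram-Schmidt makes them orthonormal and, since they are free, keeps their
    span inside the kernel. *)
Lemma unitarymx_annihilator {C : numClosedFieldType} {m n p : nat}
    (U : 'M[C]_(n, p)) :
  (m + p <= n)%N -> exists2 W : 'M[C]_(m, n), W \is unitarymx & W *m U = 0.
Proof.
move=> le_mpn; set r := \rank (kermx U).
have le_mr : (m <= r)%N.
  by rewrite /r mxrank_ker leq_subRL ?rank_leq_row // addnC
    (leq_trans _ le_mpn) // leq_add2l rank_leq_col.
pose A : 'M[C]_(m, n) := (pid_mx m : 'M[C]_(m, r)) *m row_base (kermx U).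
have free_A : row_free A.
  by rewrite /row_free mxrankMfree ?row_base_free // rank_pid_mx.
exists (schmidt A).
  by rewrite schmidt_unitarymx // (leq_trans le_mr) ?rank_leq_col.
apply/sub_kermxP; rewrite (eqmx_schmidt_free free_A).
by rewrite (submx_trans (submxMl _ _)) // eq_row_base.
Qed.

Lemma gabaseX (C : comNzRingType) (gT : finGroupType) (g : gT) (k : nat) :
  gabase C g ^+ k = gabase C (g ^+ k)%g.
Proof.
by elim: k => [|k IHk]; rewrite ?expr0 // exprS IHk expgS gabaseM.
Qed.

(** Left multiplication by [a] on the group algebra: column [j] lists the coordinates of
    [a * gabase C j]. *)
Definition regular_rep (C : comNzRingType) (m : nat)
    (a : group_algebra C (cyclic_group m.+1)) : 'M[C]_m.+1 :=
  \matrix_(i, j) a (i * j^-1 : cyclic_group m.+1)%g.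

Fact regular_rep_is_linear (C : comNzRingType) (m : nat) :
  linear (@regular_rep C m).
Proof. by move=> x a b; apply/matrixP => i j; rewrite !mxE !ffunE. Qed.

HB.instance Definition _ (C : comNzRingType) (m : nat) :=
  GRing.isLinear.Build C (group_algebra C (cyclic_group m.+1)) 'M[C]_m.+1 _
    (@regular_rep C m) (@regular_rep_is_linear C m).

Lemma regular_rep_gabase (C : comNzRingType) (m : nat)
    (g : cyclic_group m.+1) (i j : 'I_m.+1) :
  regular_rep C m (gabase C g) i j = (i == (g * j)%g :> cyclic_group m.+1)%:R.
Proof.
by rewrite mxE ffunE -(inj_eq (mulIg (j : cyclic_group m.+1))) mulgKV.
Qed.

(** The index [ord0] is the neutral element, so its basis vector is cyclic: group elements carry it
    to every other basis vector. *)
Lemma regular_rep_delta (C : comNzRingType) (m : nat) (g : cyclic_group m.+1) :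
  regular_rep C m (gabase C g) *m delta_mx ord0 ord0 =
  delta_mx (g : 'I_m.+1) ord0 :> 'cV[C]_m.+1.
Proof.
apply/matrixP => i j; rewrite -colE [LHS]mxE regular_rep_gabase (mulg1 g).
by rewrite mxE ord1 eqxx andbT.
Qed.

Lemma regular_rep_monoid_morphism (C : comNzRingType) (m : nat) :
  monoid_morphism (regular_rep C m).
Proof.
split=> [|a b]; apply/matrixP => i j.
  by rewrite regular_rep_gabase mul1g !mxE.
(* Replacing the convolution variable [h] by [i * h^-1] turns the convolution into the sum of a
   matrix product. *)
rewrite !mxE ffunE (reindex_inj (mulgI (i : cyclic_group m.+1))) /=.
rewrite (reindex_inj invg_inj) /=; apply: eq_bigr => h _; rewrite !mxE.
by rewrite invMg invgK -mulgA mulKg.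
Qed.

Lemma regular_rep_unitary (R : realType) (m : nat) :
  unitary_representation (regular_rep R[i] m).
Proof.
split=> [|g]; first exact: regular_rep_monoid_morphism.
have [rho1 rhoM] := regular_rep_monoid_morphism R[i] m.
(* Unitarity follows once the adjoint is the image of the inverse element. *)
suff rhoV : (regular_rep R[i] m (gabase R[i] g))^t* =
    regular_rep R[i] m (gabase R[i] g^-1%g).
  by apply/unitarymxP; rewrite rhoV -[LHS]rhoM -gabaseM mulgV rho1.
apply/matrixP => i j; rewrite !(mxE, ffunE) conjC_nat.
by rewrite -(inj_eq invg_inj) invMg invgK.
Qed.

Lemma periodic_mod (R : realType) (n T : nat) (D : discrete_system R n)
    (k : nat) (x : 'cV[R[i]]_n) :
  Defs.periodic T D -> state_space D x -> flow D (k %% T)%N x = flow D k x.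
Proof.
move=> perD Dx; rewrite [in RHS](divn_eq k T).
elim: (k %/ T)%N => [//|q IHq].
by rewrite mulSn -addnA addnC perD.
Qed.

(** When [Y *m X = 1%:M], the identity goes to the idempotent [X *m Y], so for [m < n] the
    homomorphism is not unital. *)
Definition conj_embed (C : comNzRingType) (m n : nat)
    (X : 'M[C]_(n, m)) (Y : 'M[C]_(m, n)) (A : 'M[C]_m) : 'M[C]_n :=
  X *m A *m Y.

Fact conj_embed_is_linear (C : comNzRingType) (m n : nat)
    (X : 'M[C]_(n, m)) (Y : 'M[C]_(m, n)) : linear (conj_embed C m n X Y).
Proof.
by move=> c A B; rewrite /conj_embed mulmxDr mulmxDl -scalemxAr -scalemxAl.
Qed.

HB.instance Definition _ (C : comNzRingType) (m n : nat)
    (X : 'M[C]_(n, m)) (Y : 'M[C]_(m, n)) :=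
  GRing.isLinear.Build C 'M[C]_m 'M[C]_n _ (conj_embed C m n X Y)
    (conj_embed_is_linear C m n X Y).

Lemma conj_embedM (C : comNzRingType) (m n : nat)
    (X : 'M[C]_(n, m)) (Y : 'M[C]_(m, n)) :
  Y *m X = 1%:M -> {morph conj_embed C m n X Y : A B / A *m B >-> A *m B}.
Proof.
move=> YX1 A B; rewrite /conj_embed.
by rewrite -(mulmxA _ Y) (mulmxA Y) -(mulmxA X) (mulmxA Y X) YX1 mul1mx !mulmxA.
Qed.

Lemma cyclic_genX (R : realType) (m k : nat) (k_lt : (k < m.+1)%N) :
  cyclic_gen R m.+1 ^+ k = gabase R[i] (Ordinal k_lt : cyclic_group m.+1).
Proof.
rewrite gabaseX; congr gabase; apply/val_inj => /=.
by rewrite Zp_expg /= modnMml mul1n modn_small.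
Qed.

Lemma is_projection1 (R : realType) (n : nat) :
  is_projection (1%:M : 'M[R[i]]_n).
Proof. by split; rewrite ?mulmx1 // trmx1 map_mx1. Qed.

Lemma is_projection_sub1 (R : realType) (m n : nat) (W : 'M[R[i]]_(m, n)) :
  W \is unitarymx -> is_projection (1%:M - W^t* *m W).
Proof.
move=> /unitarymxP WW1; split.
  by rewrite raddfB /= map_mxB trmx1 map_mx1 trmx_mul map_mxM trmxCK.
rewrite mulmxBr mulmx1 mulmxBl mul1mx -!mulmxA (mulmxA W) WW1 mul1mx.
by rewrite subrr subr0.
Qed.

Theorem theorem3p5 (R : realType) (n T : nat) (delta eps : R)
    (D : discrete_system R n)
    (delta_gt0 : 0 < delta) (eps_gt0 : 0 < eps)
    (T_gt0 : (0 < T)%N) (leTn : (2 * T <= n)%N)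
    (D_ap : almost_periodic T delta eps D) :
  controlled_system T eps D.
Proof.
move=> v [Dv _]; have {}Dv := Dv 0%N T_gt0.
case: D_ap => D' [perD' approx close].
have [x D'x le_vx] := approx _ Dv.
(* With [T] a successor, the matrix indices are the elements of [cyclic_group T]. *)
case: T => [//|m] in T_gt0 leTn v Dv perD' le_vx *.
pose U : 'M[R[i]]_(n, m.+1) := \matrix_(i, j) flow D' j x i ord0.
have [|W unitW WU0] := @unitarymx_annihilator R[i] m.+1 n m.+1 U.
  by rewrite addnn -mul2n.
have /unitarymxP WW1 := unitW.
have W_left : W *m (U + W^t* ) = 1%:M by rewrite mulmxDr WU0 WW1 add0r.
have K_right : (1%:M - W^t* *m W) *m (U + W^t* ) = U.
  by rewrite mulmxBl mul1mx -mulmxA W_left mulmx1 addrK.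
exists (regular_rep R[i] m), (conj_embed R[i] m.+1 n (U + W^t* ) W).
exists (fun k => 'X^(k %% m.+1)), (1%:M - W^t* *m W), 1%:M.
exists (W^t* *m delta_mx ord0 ord0).
split; first exact: regular_rep_unitary.
split; first exact: conj_embedM.
split.
  by move=> k; exists (k %% m.+1)%N; [exact: ltn_pmod | rewrite /= modn_mod].
split; first exact: is_projection_sub1.
split; first exact: is_projection1.
move=> k; have k_lt : (k %% m.+1 < m.+1)%N by rewrite ltn_pmod.
rewrite rmorphXn /= horner_algX cyclic_genX mulmx1 /conj_embed.
(* The controlled expression reproduces the periodic orbit of [x] exactly; the whole error [eps]
   comes from [close]. *)
suff -> : (1%:M - W^t* *m W) *m
    ((U + W^t* ) *m regular_rep _ _ (gabase _ (Ordinal k_lt)) *m W) *m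
    (W^t* *m delta_mx ord0 ord0) = flow D' k x by exact: close.
rewrite !mulmxA K_right -(mulmxA _ W) WW1 mulmx1 -mulmxA regular_rep_delta.
(* Periodicity brings time [k] back to [k %% m.+1], the index of a column of [U]. *)
rewrite -(periodic_mod _ _ _ _ _ _ perD') //.
by apply/matrixP => i j; rewrite -colE ord1 !mxE.
Qed.
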